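(* Let $E$ and $A$ be finite sets (equipped with the total $\sigma$-algebra). Fix any horizon $N\in\mathbb{N}$, put $\widetilde{E}_N=E\times\{0,\dots,N\}$, and suppose that for any $(y,s)\in\widetilde{E}\setminus\widetilde{E}_N$ it holds $g_N(y,s)=0$ and $r_n(y,s,a)=0$ for all $a\in D(y,s)$ and $n=0,\dots,N-1$. Then there exists an optimal policy $\pi^*\in F^N$.
   Context: Discrete-time semi-Markov decision process: $E$ is the state space, $\widetilde{E}=E\times\mathbb{N}_0$ the extended state space, $A$ the action space, and for each $(x,t)\in\widetilde{E}$, $D(x,t)\subseteq A$ is a nonempty set of admissible actions; $\mathcal{D}=\{(x,t,a)\in\widetilde{E}\times A:\ a\in D(x,t)\}$. $P$ is a function such that: (I) for every $(x,t,a)\in\mathcal{D}$, $(y,s)\mapsto P(y,s|x,t,a)$ is a probability mass function on $\widetilde{E}$; (II) for every $(y,s)$, $(x,t,a)\mapsto P(y,s|x,t,a)$ is measurable on $\mathcal{D}$; (III) $P(x,s|x,t,a)=0$ whenever $s\neq t+1$; (IV) $P(y,s|x,t,a)=0$ whenever $y\ne x$ and $s\ne 0$. Put $p(x|x,t,a)=P(x,t+1|x,t,a)$ and $p(y|x,t,a)=P(y,0|x,t,a)$ for $y\neq x$. A one-stage reward $\overline{r}_n(x|y,t,a)\in\mathbb{R}$ ($x\in E$, $(y,t,a)\in\mathcal{D}$, $n=0,\dots,N-1$) and a terminal reward $g_N:\widetilde{E}\to\mathbb{R}$ are given; the one-stage expected reward is $r_n(y,t,a)=\sum_{x\in E}\overline{r}_n(x|y,t,a)p(x|y,t,a)$.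 $F$ is the set of decision rules $f:\widetilde{E}\to A$ with $f(x,t)\in D(x,t)$ for all $(x,t)$; a policy is $\pi=(\pi_0,\dots,\pi_{N-1})\in F^N$. For a policy $\pi$, $n\in\{0,\dots,N\}$ and $(x,t)\in\widetilde{E}$, $\mathbb{E}_{\pi,n,(x,t)}$ is expectation under the law of the process $(X_k,\gamma_k)_{k=n,\dots,N}$ with $(X_n,\gamma_n)=(x,t)$ and, for $k=n,\dots,N-1$, conditional probability $P(y,s|X_k,\gamma_k,\pi_k(X_k,\gamma_k))$ of $(X_{k+1},\gamma_{k+1})=(y,s)$ given the past up to time $k$. The value functions are $$V_{n,\pi}(x,t)=\mathbb{E}_{\pi,n,(x,t)}\Big[\sum_{k=n}^{N-1}r_k(X_k,\gamma_k,\pi_k(X_k,\gamma_k))+g_N(X_N,\gamma_N)\Big],\qquad V_n(x,t)=\sup_{\pi\in F^N}V_{n,\pi}(x,t).$$ A policy $\pi^*$ is optimal if $V_n(x,t)=V_{n,\pi^*}(x,t)$ for all $n=0,\dots,N$ and all $(x,t)\in\widetilde{E}$. *)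

(* Defs.v *)
From HB Require Import structures.
From mathcomp Require Import all_boot all_order all_algebra.
From mathcomp Require Import all_classical all_reals all_analysis.
Set Implicit Arguments.
Unset Strict Implicit.
Unset Printing Implicit Defensive.
Import Order.TTheory GRing.Theory Num.Theory.
Local Open Scope classical_set_scope.
Local Open Scope ring_scope.

(* [discrete t0] is [T] with its total sigma-algebra. Measurable types are
   pointed; the point [t0] is immaterial, and passing it explicitly avoids
   assuming that the state and action spaces are inhabited. *)
Definition discrete (T : choiceType) (t0 : T) : Type := T.

HB.instance Definition _ (T : choiceType) (t0 : T) :=
  Choice.copy (discrete t0) T.
HB.instance Definition _ (T : choiceType) (t0 : T) :=
  isPointed.Build (discrete t0) t0.
HB.instance Definition _ (T : choiceType) (t0 : T) :=
  @isMeasurable.Build default_measure_display (discrete t0)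
    discrete_measurable discrete_measurable0
    discrete_measurableC discrete_measurableU.

(* Admissibility constrains [trans] only on triples (x, t, a) with
   a \in adm (x, t); its other values are junk and are never used.
   [trans (y, s) (x, t) a] is P(y, s | x, t, a), and
   [reward n x (y, t) a] is the one-stage reward \bar r_n(x | y, t, a). *)
Record smdp (R : realType) (E A : finType) (N : nat) := Smdp {
  adm : E * nat -> {set A};
  adm_neq0 : forall z, adm z != finset.set0;
  trans : E * nat -> E * nat -> A -> R;
  trans_ge0 : forall z a, a \in adm z -> forall z', 0 <= trans z' z a;
  trans_sum1 : forall z a, a \in adm z ->
    (\esum_(z' in [set: E * nat]) (trans z' z a)%:E = 1)%E;
  trans_measurable : forall (u0 : E * nat * A) z',
    measurable_fun [set u : discrete u0 | u.2 \in adm u.1]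
      (fun u : discrete u0 => trans z' u.1 u.2 : measurableTypeR R);
  trans_stay : forall x t a, a \in adm (x, t) ->
    forall s, s != t.+1 -> trans (x, s) (x, t) a = 0;
  trans_jump : forall x t a, a \in adm (x, t) ->
    forall y s, y != x -> s != 0%N -> trans (y, s) (x, t) a = 0;
  reward : 'I_N -> E -> E * nat -> A -> R;
  terminal : E * nat -> R }.

Section esum_scale.
Context (R : realType) (T : choiceType).
Local Open Scope ereal_scope.

Lemma esumZl (S : set T) (c : R) (a : T -> \bar R) : (0 <= c)%R ->
  (forall x, 0 <= a x) -> \esum_(x in S) (c%:E * a x) = c%:E * \esum_(x in S) a x.
Proof.
move=> c0 a0; rewrite /esum -ereal_supZl//; last first.
  by apply/set0P; exists (\sum_(x \in set0) a x), set0 => //; split.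
congr ereal_sup; apply/seteqP; split => y /=.
  move=> [A SA <-]; exists (\sum_(x \in A) a x); first by exists A.
  by rewrite ge0_mule_fsumr.
by move=> [_ [A SA <-] <-]; exists A => //; rewrite ge0_mule_fsumr.
Qed.

End esum_scale.

Section chain_mass.
Context (R : realType) (T : choiceType).
Local Open Scope ereal_scope.

Let cons_traj m (z : T) (w : {ffun 'I_m.+1 -> T}) : {ffun 'I_m.+2 -> T} :=
  [ffun i => oapp w z (unlift ord0 i)].

Lemma chain_mass1 m (q : 'I_m -> T -> T -> R) (z0 : T) :
  (forall k z z', 0 <= q k z z')%R ->
  (forall k z, \esum_(z' in [set: T]) (q k z z')%:E = 1) ->
  \esum_(w in [set w : {ffun 'I_m.+1 -> T} | w ord0 = z0])
    (\prod_(k < m) q k (w (widen_ord (leqnSn m) k)) (w (lift ord0 k)))%:E = 1.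
Proof.
elim: m q z0 => [|m IH] q z0 q0 q1.
  have -> : [set w : {ffun 'I_1 -> T} | w ord0 = z0] = [set [ffun=> z0]].
    apply/seteqP; split => w /=.
      by move=> wz; apply/ffunP => i; rewrite ffunE ord1.
    by move=> ->; rewrite ffunE.
  by rewrite esum_set1 big_ord0.
rewrite (@reindex_esum _ _ _ setT _ (cons_traj z0)); last first.
  split.
  - by move=> w _ /=; rewrite ffunE unlift_none.
  - move=> w w' _ _ /ffunP ww'; apply/ffunP => i.
    by have := ww' (lift ord0 i); rewrite !ffunE liftK.
  - move=> w /= wz; exists [ffun i => w (lift ord0 i)] => //.
    apply/ffunP => i; rewrite ffunE.
    by case: unliftP => [j|] -> /=; rewrite ?ffunE ?wz.
pose G (w : {ffun 'I_m.+1 -> T}) : R := (\prod_(k < m)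
  q (lift ord0 k) (w (widen_ord (leqnSn m) k)) (w (lift ord0 k)))%R.
have G0 w : (0 <= G w)%R by apply: prodr_ge0.
transitivity (\esum_(w in [set: {ffun 'I_m.+1 -> T}])
    ((q ord0 z0 (w ord0))%:E * (G w)%:E)).
  apply: eq_esum => w _; rewrite -EFinM; congr EFin.
  rewrite big_ord_recl; congr (_ * _)%R.
    congr (q _ _ _).
      rewrite ffunE (_ : widen_ord _ _ = ord0) ?unlift_none//.
      exact/val_inj.
    by rewrite ffunE liftK.
  apply: eq_bigr => k _; congr (q _ _ _); last by rewrite ffunE liftK.
  rewrite ffunE (_ : widen_ord _ _ = lift ord0 (widen_ord (leqnSn m) k)) ?liftK//.
  exact/val_inj.
rewrite (@reindex_esum _ _ _
  ([set: T] `*`` (fun z => [set w : {ffun 'I_m.+1 -> T} | w ord0 = z])) _ snd);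
  last first.
  split.
  - by [].
  - by move=> [z w] [z' w']; rewrite !inE /= => -[_ <-] [_ <-] ->.
  - by move=> w _; exists (w ord0, w).
transitivity (\esum_(z in [set: T])
  \esum_(w in [set w : {ffun 'I_m.+1 -> T} | w ord0 = z])
    ((q ord0 z0 z)%:E * (G w)%:E)).
  rewrite esum_esum; last first.
    by move=> z w _ _; rewrite -EFinM lee_fin mulr_ge0.
  by apply: eq_esum => -[z w] [_ /= ->].
rewrite -[RHS](q1 ord0 z0); apply: eq_esum => z _.
rewrite esumZl; [|exact: q0|by move=> w; rewrite lee_fin].
rewrite [X in _ * X](_ : _ = 1) ?mule1//.
by apply: (IH (fun k => q (lift ord0 k))) => *; [exact: q0|exact: q1].
Qed.

End chain_mass.

Section smdp_theory.
Context (R : realType) (E A : finType) (N : nat) (M : smdp R E A N).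

(* p(x | y, t, a) *)
Definition jump_prob (x : E) (z : E * nat) (a : A) : R :=
  if x == z.1 then trans M (x, z.2.+1) z a else trans M (x, 0%N) z a.

Definition expected_reward (n : 'I_N) (z : E * nat) (a : A) : R :=
  \sum_(x : E) reward M n x z a * jump_prob x z a.

Definition decision_rule := {f : E * nat -> A | forall z, f z \in adm M z}.

Definition policy := 'I_N -> decision_rule.

Definition action (pi : policy) (k : 'I_N) (z : E * nat) : A := sval (pi k) z.

(* A trajectory records (X_k, gamma_k) for all k = 0, ..., N. For the process
   started in [z] at time [n] only the coordinates k >= n matter; the earlier
   ones are frozen at [z]. *)
Definition trajectory := {ffun 'I_N.+1 -> E * nat}.

Definition now (k : 'I_N) : 'I_N.+1 := widen_ord (leqnSn N) k.
Definition next (k : 'I_N) : 'I_N.+1 := lift ord0 k.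

Definition path_mass (pi : policy) (n : 'I_N.+1) (z : E * nat)
    (w : trajectory) : R :=
  [forall k : 'I_N.+1, (k <= n)%N ==> (w k == z)]%:R *
  \prod_(k < N | (n <= k)%N) trans M (w (next k)) (w (now k))
                                   (action pi k (w (now k))).

Definition path_space (z : E * nat) :=
  discrete ([ffun=> z] : trajectory).

Definition path_law (pi : policy) (n : 'I_N.+1) (z : E * nat)
    (B : set (path_space z)) : \bar R :=
  \esum_(w in B) (path_mass pi n z w)%:E.

Lemma path_mass_ge0 pi n z w : 0 <= path_mass pi n z w.
Proof.
rewrite mulr_ge0 ?ler0n// prodr_ge0// => k _; apply: trans_ge0.
exact: (svalP (pi k)).
Qed.

Let law0 pi n z : path_law pi n (set0 : set (path_space z)) = 0%E.
Proof. by rewrite /path_law esum_set0. Qed.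

Let law_ge0 pi n z (B : set (path_space z)) : (0 <= path_law pi n B)%E.
Proof. by apply: esum_ge0 => w _; rewrite lee_fin path_mass_ge0. Qed.

Let law_sigma_additive pi n z :
  semi_sigma_additive (@path_law pi n z).
Proof.
move=> F _ tF _; rewrite /path_law.
rewrite esum_bigcupT; [|exact: tF|by move=> w; rewrite lee_fin path_mass_ge0].
rewrite -nneseries_esumT; last by move=> i; exact: law_ge0.
by apply: is_cvg_nneseries => i _ _; exact: law_ge0.
Qed.

HB.instance Definition _ pi n z := isMeasure.Build _ _ _
  (@path_law pi n z) (law0 pi n z) (@law_ge0 pi n z)
  (@law_sigma_additive pi n z).

Let step (pi : policy) (n : 'I_N.+1) (k : 'I_N) (z z' : E * nat) : R :=
  if (n <= k)%N then trans M z' z (action pi k z) else (z' == z)%:R.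

Let path_massE pi n z w : path_mass pi n z w =
  (w ord0 == z)%:R * \prod_(k < N) step pi n k (w (now k)) (w (next k)).
Proof.
rewrite /path_mass [in RHS](bigID (fun k : 'I_N => (n <= k)%N)) /=.
rewrite mulrCA [LHS]mulrC; congr (_ * _).
  by apply: eq_bigr => k nk; rewrite /step nk.
have [/forallP wz|] := boolP [forall k : 'I_N.+1, (k <= n)%N ==> (w k == z)].
  rewrite (implyP (wz ord0))// mul1r big1// => k; rewrite -ltnNge => kn.
  rewrite /step leqNgt kn/= (eqP (implyP (wz (next k)) _))//.
  by rewrite (eqP (implyP (wz (now k)) _)) ?eqxx// ltnW.
rewrite negb_forall => /existsP[k]; rewrite negb_imply => /andP[kn wkz].
have [w0|] := eqVneq (w ord0) z; last by rewrite mul0r.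
rewrite mul1r; apply/esym/eqP; apply: contraNT wkz => /prodf_neq0 pn0.
suff H m (mN : (m < N.+1)%N) : (m <= n)%N -> w (Ordinal mN) = z.
  by apply/eqP; have := H k (ltn_ord k) kn; congr (_ = _); congr (w _); exact/val_inj.
elim: m mN => [|m IHm] mN mn.
  by rewrite -[RHS]w0; congr (w _); exact/val_inj.
have mN' : (m < N)%N by [].
have := pn0 (Ordinal mN'); rewrite /= -ltnNge => /(_ mn).
rewrite /step /= leqNgt mn/= pnatr_eq0 eqb0 negbK => /eqP.
rewrite (_ : next _ = Ordinal mN); last exact/val_inj.
move=> ->; rewrite -(IHm (ltnW mN) (ltnW mn)).
by congr (w _); exact/val_inj.
Qed.

Let law_setT pi n z : path_law pi n [set: path_space z] = 1%E.
Proof.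
rewrite -[RHS](@chain_mass1 _ _ _ (step pi n) z).
- rewrite [RHS]esum_mkcond; apply: eq_esum => w _; rewrite path_massE.
  case: ifPn => [|]; rewrite ?notin_setE ?inE /=.
    by move=> ->; rewrite eqxx mul1r.
  by move=> /eqP/negPf ->; rewrite mul0r.
- move=> k y y'; rewrite /step; case: ifPn => // _; apply: trans_ge0.
  exact: (svalP (pi k)).
- move=> k y; rewrite /step; case: (leqP n k) => _.
    exact/trans_sum1/(svalP (pi k)).
  rewrite (esumID [set y])// [X in (_ + X)%E]esum1 ?adde0; last first.
    by move=> y' [_ /= /eqP/negPf ->].
  by rewrite setTI esum_set1 eqxx.
Qed.

HB.instance Definition _ pi n z := Measure_isProbability.Build _ _ _
  (@path_law pi n z) (law_setT pi n z).

Definition total_reward (pi : policy) (n : 'I_N.+1) (w : trajectory) : R :=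
  \sum_(k < N | (n <= k)%N)
    expected_reward k (w (now k)) (action pi k (w (now k)))
  + terminal M (w ord_max).

Definition policy_value (pi : policy) (n : 'I_N.+1) (z : E * nat) : \bar R :=
  'E_(@path_law pi n z)[total_reward pi n]%E.

Definition value (n : 'I_N.+1) (z : E * nat) : \bar R :=
  ereal_sup [set policy_value pi n z | pi in [set: policy]].

Definition optimal (pi : policy) : Prop :=
  forall n z, value n z = policy_value pi n z.

End smdp_theory.

(* Main.v *)
(* From (x, t) the chain can only move to (x, t+1) or to (y, 0) with y <> x, so
   a process started in a given state follows one of finitely many trajectories.
   Value functions are therefore finite sums and satisfy the reward iteration
   V_{n,pi}(z) = r_n(z, a) + \sum_y p(y | z, a) V_{n+1,pi}(z_y), a = pi_n(z),
   with z_y the successor of z in which the E-component is y. As A is finite, a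
   maximizing action exists in every state and at every stage; the policy built
   backward in time from maximizers dominates every other policy at each (n, z).
   That a list of trajectories exhausts the possible ones is obtained without
   case analysis: its total mass is 1, so the path law is supported on it. *)
Require Import Defs.
From mathcomp Require Import all_boot all_order all_algebra.
From mathcomp Require Import all_classical all_reals all_analysis.
Set Implicit Arguments.
Unset Strict Implicit.
Unset Printing Implicit Defensive.
Import Order.TTheory GRing.Theory Num.Theory.
Local Open Scope ring_scope.

(** * Expectations under finitely supported probability measures *)

Lemma probability_seq d (T : measurableType d) (R : realType)
    (P : probability T R) (s : seq T) :
  (forall x : T, measurable [set x]%classic) -> uniq s ->
  (P [set` s]%classic = \sum_(x <- s) P [set x]%classic)%E.
Proof.
move=> m1.
have consE x s' : [set` x :: s']%classic = ([set x] `|` [set` s'])%classic.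
  by apply/seteqP; split => y /=; rewrite in_cons => /predU1P.
elim: s => [|x s IHs] /=.
  by rewrite set_nil measure0 big_nil.
move=> /andP[xs us]; rewrite consE big_cons measureU//.
- by congr (_ + _)%E; exact: IHs.
- elim: s {IHs xs us} => [|y s IHs]; first by rewrite set_nil.
  by rewrite consE; exact: measurableU.
- by apply/seteqP; split => // y [/= ->]; rewrite (negPf xs).
Qed.

(** Since [s] carries all the mass, [f] agrees almost surely with a finite combination of point
    indicators, which is integrated term by term. *)
Lemma expectation_finite_support d (T : measurableType d) (R : realType)
    (P : probability T R) (s : seq T) (f : T -> R) :
  (forall B : set T, measurable B) -> uniq s ->
  (\sum_(x <- s) P [set x]%classic = 1)%E ->
  ('E_P[f] = \sum_(x <- s) (f x)%:E * P [set x]%classic)%E.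
Proof.
move=> mT us s1; rewrite unlock.
pose g x : \bar R := (\sum_(y <- s) (f y)%:E * (\1_[set y]%classic x)%:E)%E.
transitivity (\int[P]_x g x)%E.
  apply: ae_eq_integral => //; exists (~` [set` s])%classic; split => //.
    by rewrite [LHS](probability_setC P (mT _)) probability_seq// s1 subee.
  move=> x /= /not_implyP[_ +] xs; apply.
  rewrite /g (bigD1_seq x)//= indicE mem_set// mule1 big1 ?adde0// => y yx.
  by rewrite indicE memNset ?mule0// => /= xy; rewrite xy eqxx in yx.
rewrite integral_sum// => [|y]; last first.
  by apply: integrableZl => //; exact: integrable_indic.
apply: eq_bigr => y _; rewrite integralZl//; last exact: integrable_indic.
by rewrite integral_indic// setIT.
Qed.

Section finite_horizon.
Context (R : realType) (E A : finType) (N : nat) (M : smdp R E A N).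
Implicit Types (z : E * nat) (y : E) (k : 'I_N) (n : 'I_N.+1) (pi : policy M).
Implicit Types (w : trajectory E N).

Definition successor z y : E * nat := (y, if y == z.1 then z.2.+1 else 0%N).

Lemma jump_probE y z a : jump_prob M y z a = trans M (successor z y) z a.
Proof. by rewrite /jump_prob /successor; case: eqP. Qed.

Lemma jump_prob_ge0 y z a : a \in adm M z -> 0 <= jump_prob M y z a.
Proof. by move=> az; rewrite jump_probE trans_ge0. Qed.

(** [trans_stay] and [trans_jump] make [trans] vanish off the range of the injective map
    [successor z], so its total mass 1 is a finite sum over [E]. *)
Lemma jump_prob_sum1 z a : a \in adm M z -> \sum_y jump_prob M y z a = 1.
Proof.
move=> az; apply: EFin_inj; rewrite -(trans_sum1 az) -sumEFin.
rewrite (esumID (range (successor z)))//; last by move=> *; rewrite lee_fin trans_ge0.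
rewrite setTI [X in (_ + X)%E]esum1 ?adde0.
  rewrite esum_image; last by move=> y y' _ _ [].
  rewrite esum_fset; last 2 first.
  - exact: finite_finset.
  - by move=> *; rewrite lee_fin trans_ge0.
  rewrite (_ : setT = [set` enum E])%classic; last first.
    by apply/esym/seteqP; split => // y _ /=; rewrite mem_enum.
  rewrite -fsbig_seq ?enum_uniq// big_enum.
  by apply: eq_bigr => y _; rewrite jump_probE.
move=> [y s] [_ /= nr]; case: z az nr => x t az nr.
congr EFin; have [yx|yx] := eqVneq y x.
  rewrite yx in nr *; apply: trans_stay => //; apply/eqP => st.
  by apply: nr; exists x => //; rewrite /successor/= eqxx st.
apply: trans_jump => //; apply/eqP => s0.
by apply: nr; exists y => //; rewrite /successor/= (negPf yx) s0.
Qed.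

(** * Backward recursion and the enumeration of trajectories *)

Lemma backward_ind (Q : 'I_N.+1 -> Prop) :
  Q ord_max -> (forall k, Q (Defs.next k) -> Q (now k)) -> forall n, Q n.
Proof.
move=> Qmax Qstep n; have [m Nnm] := ubnP (N - n).
elim: m n Nnm => // m IHm n Nnm.
have [nN|Nn] := ltnP n N; last first.
  by rewrite (_ : n = ord_max)//; apply/val_inj/eqP; rewrite eqn_leq Nn -ltnS ltn_ord.
rewrite (_ : n = now (Ordinal nN)); last exact/val_inj.
apply/Qstep/IHm; rewrite /= /bump /= add1n.
by rewrite -ltnS (leq_trans _ Nnm)// ltnS ltn_sub2l.
Qed.

(** The stages from [n] on act on [t], the latest one first. This serves both to list the
    trajectories and to build the optimal value function. *)
Definition backward T (F : 'I_N -> T -> T) (t : T) n : T :=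
  foldr F t (drop n (enum 'I_N)).

Lemma backward_max T (F : 'I_N -> T -> T) t : backward F t ord_max = t.
Proof. by rewrite /backward drop_oversize// size_enum_ord. Qed.

Lemma backward_now T (F : 'I_N -> T -> T) t k :
  backward F t (now k) = F k (backward F t (Defs.next k)).
Proof.
by rewrite /backward (drop_nth k) ?size_enum_ord//= nth_ord_enum.
Qed.

(** Coordinates before [k] are overwritten too, in line with [path_mass], which freezes the past at
    the starting state. *)
Definition prepend k z w : trajectory E N :=
  [ffun i : 'I_N.+1 => if (i <= k)%N then z else w i].

Definition paths : 'I_N.+1 -> E * nat -> seq (trajectory E N) :=
  backward
    (fun k S z => [seq prepend k z w | y <- enum E, w <- S (successor z y)])
    (fun z => [:: [ffun=> z]]).

Lemma paths_max z : paths ord_max z = [:: [ffun=> z]].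
Proof. by rewrite /paths backward_max. Qed.

Lemma paths_now k z : paths (now k) z =
  [seq prepend k z w | y <- enum E, w <- paths (Defs.next k) (successor z y)].
Proof. by rewrite /paths backward_now. Qed.

Lemma paths_prefix n z w : w \in paths n z ->
  forall i : 'I_N.+1, (i <= n)%N -> w i = z.
Proof.
move: n z w; apply: backward_ind => [|k _] z w.
  by rewrite paths_max inE => /eqP -> i _; rewrite ffunE.
rewrite paths_now => /allpairsPdep[y [w' [_ _ ->]]] i ik.
by rewrite ffunE ik.
Qed.

(** Prepending loses no information: coordinate [k + 1] still reveals [y], and the overwritten
    coordinates were all equal to [successor z y]. *)
Lemma paths_uniq n z : uniq (paths n z).
Proof.
move: n z; apply: backward_ind => [|k IHk] z.
  by rewrite paths_max.
rewrite paths_now; apply: allpairs_uniq_dep => [|y _|].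
- exact: enum_uniq.
- exact: IHk.
move=> _ _ /allpairsPdep[y [w [_ wy ->]]] /allpairsPdep[y' [w' [_ wy' ->]]] /=.
move=> /ffunP ww'.
have {}ww' (i : 'I_N.+1) : (k < i)%N -> w i = w' i.
  by move=> ki; have := ww' i; rewrite !ffunE leqNgt ki.
have kS : (k < Defs.next k)%N by rewrite /= /bump add1n.
have yy' : y = y'.
  have := ww' _ kS.
  by rewrite (paths_prefix wy)// (paths_prefix wy')// => -[].
rewrite -yy' in wy' *; congr (existT _ _ _); apply/ffunP => i.
have [ki|ik] := ltnP k i; first exact: ww'.
have iS : (i <= Defs.next k)%N by rewrite (leq_trans ik)// ltnW.
by rewrite (paths_prefix wy)// (paths_prefix wy').
Qed.

(** * First-step decomposition of masses and rewards *)

Lemma big_from_now (V : Type) (idx : V) (op : Monoid.com_law idx)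
    (F : 'I_N -> V) k :
  \big[op/idx]_(i < N | (now k <= i)%N) F i =
  op (F k) (\big[op/idx]_(i < N | (Defs.next k <= i)%N) F i).
Proof.
rewrite (bigD1 k)//=; congr (op _ _); apply: eq_bigl => i.
by rewrite /bump add1n ltn_neqAle eq_sym andbC.
Qed.

Lemma prepend_now k z w : prepend k z w (now k) = z.
Proof. by rewrite ffunE leqnn. Qed.

Lemma prepend_after k z w (i : 'I_N.+1) : (k < i)%N -> prepend k z w i = w i.
Proof. by move=> ki; rewrite ffunE leqNgt ki. Qed.

(** Both freezing conditions hold, so the masses differ only by the transition factor of stage [k];
    the later factors involve coordinates beyond [k], which [prepend] keeps. *)
Lemma path_mass_prepend pi k z y w : w \in paths (Defs.next k) (successor z y) ->
  path_mass pi (now k) z (prepend k z w) =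
  jump_prob M y z (action pi k z) *
    path_mass pi (Defs.next k) (successor z y) w.
Proof.
move=> /paths_prefix wE; rewrite /path_mass big_from_now.
have -> : [forall i : 'I_N.+1, (i <= now k)%N ==> (prepend k z w i == z)].
  by apply/forallP => i; apply/implyP => ik; rewrite ffunE ik.
have -> : [forall i : 'I_N.+1,
    (i <= Defs.next k)%N ==> (w i == successor z y)].
  by apply/forallP => i; apply/implyP => /wE ->.
rewrite !mul1r prepend_now prepend_after ?wE//=.
rewrite jump_probE; congr (_ * _); apply: eq_bigr => i; rewrite /= /bump !add1n => ki.
by rewrite !prepend_after//= /bump add1n ltnS ltnW.
Qed.

Lemma total_reward_prepend pi k z w :
  total_reward pi (now k) (prepend k z w) =
  expected_reward M k z (action pi k z) + total_reward pi (Defs.next k) w.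
Proof.
rewrite /total_reward big_from_now -addrA prepend_now prepend_after//=.
congr (_ + (_ + _)); apply: eq_bigr => i; rewrite /bump add1n => ki.
by rewrite prepend_after.
Qed.

(** The tower property, conditioning on the state at stage [k + 1]. *)
Lemma path_sum_now pi k z (f : trajectory E N -> R) :
  \sum_(w <- paths (now k) z) path_mass pi (now k) z w * f w =
  \sum_y jump_prob M y z (action pi k z) *
    \sum_(w <- paths (Defs.next k) (successor z y))
      path_mass pi (Defs.next k) (successor z y) w * f (prepend k z w).
Proof.
rewrite paths_now big_allpairs_dep big_enum.
apply: eq_bigr => y _; rewrite mulr_sumr [LHS]big_seq [RHS]big_seq.
by apply: eq_bigr => w wy; rewrite (path_mass_prepend _ wy) mulrA.
Qed.

Lemma path_sum_max pi z (f : trajectory E N -> R) :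
  \sum_(w <- paths ord_max z) path_mass pi ord_max z w * f w = f [ffun=> z].
Proof.
rewrite paths_max big_seq1 /path_mass big1 ?mulr1; last first.
  by move=> i; rewrite leqNgt ltn_ord.
have -> : [forall i : 'I_N.+1, (i <= N)%N ==> ([ffun=> z] i == z)].
  by apply/forallP => i; rewrite ffunE eqxx implybT.
by rewrite mul1r.
Qed.

Lemma action_adm pi k z : action pi k z \in adm M z.
Proof. exact: (svalP (pi k)). Qed.

Lemma path_mass_sum1 pi n z : \sum_(w <- paths n z) path_mass pi n z w = 1.
Proof.
(* The constant integrand 1 gives the sum the form handled by [path_sum_max] and [path_sum_now]. *)
under eq_bigr do rewrite -[path_mass _ _ _ _]mulr1.
move: n z; apply: backward_ind => [|k IHk] z; first exact: path_sum_max.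
rewrite path_sum_now -[RHS](jump_prob_sum1 (action_adm pi k z)).
by apply: eq_bigr => y _; rewrite IHk mulr1.
Qed.

Definition path_value pi n z : R :=
  \sum_(w <- paths n z) path_mass pi n z w * total_reward pi n w.

Lemma path_law1 pi n z w :
  @path_law _ _ _ _ M pi n z [set w]%classic = (path_mass pi n z w)%:E.
Proof. by rewrite /path_law esum_set1// lee_fin path_mass_ge0. Qed.

(** This turns the integral into a real finite sum; [path_mass_sum1] excludes mass outside
    [paths n z]. *)
Lemma policy_valueE pi n z : policy_value pi n z = (path_value pi n z)%:E.
Proof.
rewrite /policy_value (@expectation_finite_support _ (path_space N z) _ _ (paths n z))//.
- rewrite -sumEFin; apply: eq_bigr => w _.
  by rewrite mulrC EFinM; congr (_ * _)%E; exact: path_law1.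
- exact: paths_uniq.
- rewrite -(path_mass_sum1 pi n z) -sumEFin.
  by apply: eq_bigr => w _; exact: path_law1.
Qed.

(** The Q-function of dynamic programming, with [J] as the value of the continuation. *)
Definition action_value (J : E * nat -> R) k z (a : A) : R :=
  expected_reward M k z a + \sum_y jump_prob M y z a * J (successor z y).

Lemma path_value_max pi z : path_value pi ord_max z = terminal M z.
Proof.
rewrite /path_value path_sum_max /total_reward big1 ?add0r ?ffunE//.
by move=> i; rewrite leqNgt ltn_ord.
Qed.

Lemma path_value_now pi k z : path_value pi (now k) z =
  action_value (path_value pi (Defs.next k)) k z (action pi k z).
Proof.
rewrite /path_value path_sum_now /action_value.
(* The immediate reward does not depend on [y]; multiplied by the total jump probability 1, it moves
   inside the sum over [y]. *)
rewrite -[X in X + _]mulr1 -(jump_prob_sum1 (action_adm pi k z)).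
rewrite mulr_sumr -big_split/=; apply: eq_bigr => y _.
under eq_bigr do rewrite total_reward_prepend mulrDr.
by rewrite big_split/= -mulr_suml path_mass_sum1 mul1r mulrDr [in X in X + _]mulrC.
Qed.

Lemma le_action_value (J J' : E * nat -> R) k z a : a \in adm M z ->
  (forall z', J z' <= J' z') -> action_value J k z a <= action_value J' k z a.
Proof.
move=> az JJ'; rewrite lerD2l; apply: ler_sum => y _.
by rewrite ler_wpM2l// jump_prob_ge0.
Qed.

Lemma greedy_rule (Q : E * nat -> A -> R) : exists f : decision_rule M,
  forall z a, a \in adm M z -> Q z a <= Q z (sval f z).
Proof.
have /choice[f fQ] z : exists a0, a0 \in adm M z /\
    forall a, a \in adm M z -> Q z a <= Q z a0.
  have /set0Pn[a0 a0z] := adm_neq0 M z.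
  by case: (@arg_maxP _ _ _ a0 (mem (adm M z)) (Q z) a0z) => a az aQ; exists a.
exists (exist _ f (fun z => (fQ z).1)) => z a; exact: (fQ z).2.
Qed.

End finite_horizon.

Theorem theorem3p8 (R : realType) (E A : finType) (N : nat) (hN : (0 < N)%N)
    (M : smdp R E A N)
    (hzero : forall (y : E) (s : nat), (N < s)%N ->
      terminal M (y, s) = 0 /\
      forall a : A, a \in adm M (y, s) ->
        forall n : 'I_N, expected_reward M n (y, s) a = 0) :
  exists pi : policy M, optimal pi.
Proof.
(* Fixing one greedy rule for each [Q] lets [F] and [pistar] share their maximizers: [J] is built
   first, without reference to a policy, and then identified with the value of [pistar]. *)
have /choice[greedy greedyP] := @greedy_rule _ _ _ _ M.
(* [F k] is the Bellman optimality operator: by [greedyP] the chosen action attains the maximum over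
   admissible actions. *)
pose F k J z := action_value M J k z (sval (greedy (action_value M J k)) z).
pose J := backward F (terminal M).
pose pistar : policy M := fun k => greedy (action_value M (J (Defs.next k)) k).
have pistarE n z : path_value pistar n z = J n z.
  move: n z; apply: backward_ind => [|k IHk] z.
    by rewrite path_value_max /J backward_max.
  by rewrite path_value_now (funext IHk) /J backward_now.
have le_pistar (pi : policy M) n z : path_value pi n z <= path_value pistar n z.
  move: n z; apply: backward_ind => [|k IHk] z; first by rewrite !path_value_max.
  (* With the action of [pi] kept at stage [k], passing to the continuation value of [pistar] can
     only increase the value; the greedy action then does at least as well. *)
  rewrite !path_value_now (le_trans (le_action_value _ (action_adm _ _ _) IHk))//.
  by rewrite (funext (pistarE _)); exact/greedyP/action_adm.
exists pistar => n z; apply/eqP; rewrite eq_le; apply/andP; split.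
  apply: ge_ereal_sup => _ [pi _ <-].
  by rewrite !policy_valueE lee_fin.
by apply: ereal_sup_ubound; exists pistar.
Qed.
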